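(* Let $(M,\omega)$ be a closed symplectic manifold and let $\mathcal{D}=(\mathfrak{r},J,\{e_n\}_{n\ge1},\{Z_n\}_{n\ge1})$ be a law-defining datum on it. Then for any $\psi\in\mathrm{Symp}(M,\omega)$ we have $$\psi_*\mu_{\mathrm{Ham}}^{\mathcal{D}}=\mu_{\mathrm{Ham}}^{\psi_*\mathcal{D}}.$$
   Context: For $H\in C^\infty([0,1]\times M)$, $X_H$ is defined by $\omega(X_H,\cdot)=-dH$, $\phi_H^t$ denotes its flow, and $\mathrm{Ham}(M,\omega)=\{\phi_H^1\}$. $C_0^\infty([0,1]\times M)$ is the set of $H$ with $\int_M H(t,x)\,\omega^{\dim M/2}=0$ for all $t$. The Hofer norm is $\|\phi\|_{\mathrm{Hofer}}=\inf\{\int_0^1(\max_M H(t,\cdot)-\min_M H(t,\cdot))\,dt : \phi_H^1=\phi\}$ and $d_{\mathrm{Hofer}}(\phi,\psi)=\|\phi^{-1}\circ\psi\|_{\mathrm{Hofer}}$. A law-defining datum $\mathcal{D}$ on $(M,\omega)$ is a tuple $(\mathfrak{r},J,\{e_n\}_{n\ge1},\{Z_n\}_{n\ge1})$ where: (1) $\mathfrak{r}>0$; (2) $J$ is an $\omega$-compatible almost complex structure, with metric $g=\omega(\cdot,J\cdot)$; (3) $\{1/\sqrt{\mathrm{vol}_g(M)},e_1,e_2,\dots\}$ is an orthonormal basis of $L^2(M,g)$ with $e_n$ an eigenfunction of the Laplace-Beltrami operator $\Delta_g$ with eigenvalue $\lambda_n$, where $0=\lambda_0<\lambda_1\le\lambda_2\le\dots$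 are the eigenvalues with multiplicity; (4) $\{Z_n\}$ is a family of Gaussian processes on $[0,1]$ such that for some constants $C,D\ge0$ one has $\mathrm{Cov}[Z_n(t),Z_n(t)]<C$ and $\mathbb{E}[\|Z_n\|_\infty]<D$ for all $n,t$, and such that $(t_1,t_2)\mapsto\mathrm{Cov}[Z_n(t_1),Z_n(t_2)]$ and $t\mapsto\mathbb{E}[Z_n(t)]$ are smooth for every $n$ (so sample paths are almost surely smooth). The random Hamiltonian associated with $\mathcal{D}$ is $H^{\mathrm{rand}}(t,x)=\sum_{n\ge1}w_nZ_n(t)e_n(x)$ with $w_n=\exp(-\tfrac12\lambda_n\mathfrak{r})$; it lies almost surely in $C_0^\infty([0,1]\times M)$. The law of $\phi^1_{H^{\mathrm{rand}}}$ is a Borel probability measure $\mu_{\mathrm{Ham}}^{\mathcal{D}}$ on $(\mathrm{Ham}(M,\omega),d_{\mathrm{Hofer}})$. For $\psi\in\mathrm{Symp}(M,\omega)$ and a Borel measure $\mu$ on $\mathrm{Ham}(M,\omega)$, the push-forward by conjugation is $(\psi_*\mu)(A)=\mu(\psi^{-1}A\psi)$ for Borel $A\subseteq\mathrm{Ham}(M,\omega)$. The push-forward almost complex structure is $(\psi_*J)_x=d\psi_{\psi^{-1}(x)}\circ J_{\psi^{-1}(x)}\circ d\psi^{-1}_x$, and the push-forward law-defining datum is $\psi_*\mathcal{D}=(\mathfrak{r},\psi_*J,\{e_n\circ\psi^{-1}\}_{n\ge1},\{Z_n\}_{n\ge1})$, which is again a law-defining datum. *)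

(* Defs.v *)
From HB Require Import structures.
From mathcomp Require Import all_boot all_order all_algebra.
From mathcomp Require Import all_classical all_reals all_analysis.

Set Implicit Arguments.
Unset Strict Implicit.
Unset Printing Implicit Defensive.

Import Order.TTheory GRing.Theory Num.Theory.
Import numFieldNormedType.Exports.

Local Open Scope classical_set_scope.
Local Open Scope ring_scope.

Definition unit_itv (R : realType) : set R := `[0, 1]%classic.
Arguments unit_itv {R} _.

Section euclidean.
Context {R : realType}.

Fixpoint Ck (n k : nat) (W : set 'rV[R]_n) (f : 'rV[R]_n -> R) : Prop :=
  {within W, continuous f} /\
  match k with
  | 0 => True
  | k'.+1 => forall i : 'I_n,
      (forall x, W x -> derivable f x (delta_mx 0 i)) /\
      Ck k' W ('D_(delta_mx 0 i) f)
  end.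

(* [A] is arbitrary: [f] is smooth on [A] when it locally extends to a smooth
   function on an open set; this covers half-open coordinate domains such as
   [0,1] x V. *)
Definition smooth_on (n : nat) (A : set 'rV[R]_n) (f : 'rV[R]_n -> R) : Prop :=
  forall p, A p -> exists (W : set 'rV[R]_n) (h : 'rV[R]_n -> R),
    [/\ open W, W p, forall k, Ck k W h & forall x, A x -> W x -> h x = f x].

(* For Borel [F] with values in [0, +oo] this is, by Tonelli, the integral
   against n-dimensional Lebesgue measure. *)
Fixpoint lebesgue_iint (n : nat) : ('rV[R]_n -> \bar R) -> \bar R :=
  match n return ('rV[R]_n -> \bar R) -> \bar R with
  | 0 => fun F => F 0
  | n'.+1 => fun F =>
      (\int[lebesgue_measure]_(t in [set: R])
        lebesgue_iint (fun v : 'rV[R]_n' => F (row_mx (t%:M : 'rV[R]_1) v)))%E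
  end.

Definition smooth_time (f : R -> R) : Prop :=
  smooth_on [set v : 'rV[R]_1 | unit_itv (v 0 0)] (fun v => f (v 0 0)).

Definition smooth_time2 (f : R -> R -> R) : Prop :=
  smooth_on [set v : 'rV[R]_2 | forall i, unit_itv (v 0 i)]
            (fun v => f (v 0 0) (v 0 1)).

End euclidean.

(* [cfun] is only meaningful on [cdom], and [cinv] on [cim]. *)
Record chart (R : realType) (d : nat) (T : Type) := Chart {
  cdom : set T;
  cfun : T -> 'rV[R]_d;
  cinv : 'rV[R]_d -> T }.

Section charts.
Context {R : realType} {d : nat} {T : topologicalType}.
Implicit Types c : chart R d T.

Definition cim c : set 'rV[R]_d := cfun c @` cdom c.

Definition is_chart c : Prop :=
  [/\ open (cdom c), open (cim c), forall x, cdom c x -> cinv c (cfun c x) = x,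
      {within cdom c, continuous (cfun c)} &
      {within cim c, continuous (cinv c)}].

Definition smooth_transition c c' : Prop := forall i : 'I_d,
  smooth_on (cfun c @` (cdom c `&` cdom c')) (fun v => cfun c' (cinv c v) 0 i).

Definition chart_compatible c c' : Prop :=
  smooth_transition c c' /\ smooth_transition c' c.

End charts.

(* The base point of the [ptopologicalType] only records that the manifold is
   nonempty; it is needed to form the Borel [measurableType]. Second
   countability follows from compactness. The atlas is the maximal one. *)
Record closed_manifold (R : realType) (d : nat) := ClosedManifold {
  mcarrier :> ptopologicalType;
  atlas : set (chart R d mcarrier);
  mfd_hausdorff : hausdorff_space mcarrier;
  mfd_compact : compact [set: mcarrier];
  atlas_cover : forall x, exists2 c, atlas c & cdom c x;
  atlas_chart : forall c, atlas c -> is_chart c;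
  atlas_compatible : forall c c', atlas c -> atlas c' -> chart_compatible c c';
  atlas_maximal : forall c, is_chart c ->
    (forall c', atlas c' -> chart_compatible c c') -> atlas c }.

Record self_bij (T : Type) := SelfBij {
  sb_fun :> T -> T;
  sb_inv : T -> T;
  sb_funK : cancel sb_fun sb_inv;
  sb_invK : cancel sb_inv sb_fun }.

Definition sbV (T : Type) (f : self_bij T) : self_bij T :=
  SelfBij (sb_invK f) (sb_funK f).

Definition sb_comp (T : Type) (f g : self_bij T) : self_bij T :=
  @SelfBij T (f \o g) (sb_inv g \o sb_inv f)
    (can_comp (sb_funK f) (sb_funK g)) (can_comp (sb_invK g) (sb_invK f)).

Section calculus.
Context {R : realType} {d : nat} (M : closed_manifold R d).

Definition smooth (f : M -> R) : Prop :=
  forall c, atlas c -> smooth_on (cim c) (f \o cinv c).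

Definition smooth_map (psi : M -> M) : Prop :=
  continuous psi /\
  forall c c', atlas c -> atlas c' -> forall i : 'I_d,
    smooth_on (cfun c @` (cdom c `&` psi @^-1` cdom c'))
              (fun v => cfun c' (psi (cinv c v)) 0 i).

(* T_x M is the space of derivations of the algebra of smooth functions at x.
   Derivations are extended by 0 to non-smooth functions, so that Leibniz
   equality of [tvec]s is equality of derivations. *)
Definition tvec : Type := (M -> R) -> R.

Definition tlin (a : R) (v w : tvec) : tvec := fun f => a * v f + w f.

Definition tangent (x : M) : set tvec := [set v |
  [/\ forall f, ~ smooth f -> v f = 0,
      forall a f g, smooth f -> smooth g ->
        v (fun y => a * f y + g y) = a * v f + v g &
      forall f g, smooth f -> smooth g ->
        v (fun y => f y * g y) = f x * v g + g x * v f]].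

Definition differential (psi : M -> M) (v : tvec) : tvec :=
  fun f => v (f \o psi).

Definition coord_vec (c : chart R d M) (x : M) (i : 'I_d) : tvec := fun f =>
  if `[< smooth f >] then 'D_(delta_mx 0 i) (f \o cinv c) (cfun c x) else 0.

Definition smooth_vfield (X : M -> tvec) : Prop :=
  (forall x, tangent x (X x)) /\
  forall f, smooth f -> smooth (fun x => X x f).

Definition lie_bracket (X Y : M -> tvec) : M -> tvec := fun x f =>
  X x (fun y => Y y f) - Y x (fun y => X y f).

Definition bilinear_form (x : M) (b : tvec -> tvec -> R) : Prop :=
  forall a u v w, tangent x u -> tangent x v -> tangent x w ->
    b (tlin a u v) w = a * b u w + b v w /\
    b w (tlin a u v) = a * b w u + b w v.

(* Smooth (0,2)-tensor fields; [B x] only matters on [tangent x]. *)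
Definition smooth_bilinear (B : M -> tvec -> tvec -> R) : Prop :=
  (forall x, bilinear_form x (B x)) /\
  forall X Y, smooth_vfield X -> smooth_vfield Y ->
    smooth (fun x => B x (X x) (Y x)).

(* d omega (X, Y, Z), by the invariant formula for the exterior derivative. *)
Definition ext_deriv2 (omega : M -> tvec -> tvec -> R) (X Y Z : M -> tvec)
    (x : M) : R :=
    X x (fun y => omega y (Y y) (Z y))
  + Y x (fun y => omega y (Z y) (X y))
  + Z x (fun y => omega y (X y) (Y y))
  - omega x (lie_bracket X Y x) (Z x)
  - omega x (lie_bracket Y Z x) (X x)
  - omega x (lie_bracket Z X x) (Y x).

Definition symplectic_form (omega : M -> tvec -> tvec -> R) : Prop :=
  [/\ smooth_bilinear omega,
      forall x v, tangent x v -> omega x v v = 0,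
      forall x v, tangent x v ->
        (forall w, tangent x w -> omega x v w = 0) -> v = (fun=> 0) &
      forall X Y Z, smooth_vfield X -> smooth_vfield Y -> smooth_vfield Z ->
        forall x, ext_deriv2 omega X Y Z x = 0].

Definition Symp (omega : M -> tvec -> tvec -> R) : set (self_bij M) :=
  [set psi : self_bij M | [/\ smooth_map psi, smooth_map (sbV psi) &
    forall x v w, tangent x v -> tangent x w ->
      omega (psi x) (differential psi v) (differential psi w) = omega x v w]].

Definition almost_complex (J : M -> tvec -> tvec) : Prop :=
  [/\ forall x v, tangent x v -> tangent x (J x v),
      forall x a v w, tangent x v -> tangent x w ->
        J x (tlin a v w) = tlin a (J x v) (J x w),
      forall x v, tangent x v -> J x (J x v) = (fun f => - v f) &
      forall X, smooth_vfield X -> smooth_vfield (fun x => J x (X x))].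

Definition riemannian_metric (g : M -> tvec -> tvec -> R) : Prop :=
  [/\ smooth_bilinear g,
      forall x v w, tangent x v -> tangent x w -> g x v w = g x w v &
      forall x v, tangent x v -> v <> (fun=> 0) -> 0 < g x v v].

Definition metric_of (omega : M -> tvec -> tvec -> R) (J : M -> tvec -> tvec) :
  M -> tvec -> tvec -> R := fun x v w => omega x v (J x w).

Definition compatible_acs (omega : M -> tvec -> tvec -> R)
    (J : M -> tvec -> tvec) : Prop :=
  almost_complex J /\ riemannian_metric (metric_of omega J).

End calculus.

Notation borel M := (g_sigma_algebraType (@open M)).

Section riemannian.
Context {R : realType} {d : nat} (M : closed_manifold R d).
Variable g : M -> tvec M -> tvec M -> R.

Definition gram (c : chart R d M) (v : 'rV[R]_d) : 'M[R]_d :=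
  \matrix_(i, j) g (cinv c v) (coord_vec c (cinv c v) i)
                              (coord_vec c (cinv c v) j).

Definition vol_density (c : chart R d M) (v : 'rV[R]_d) : R :=
  Num.sqrt (\det (gram c v)).

Definition is_volume (mu : {measure set (borel M) -> \bar R}) : Prop :=
  forall (c : chart R d M) (A : set (borel M)),
    atlas c -> measurable A -> A `<=` cdom c ->
    mu A = lebesgue_iint
      (fun v => (\1_(cfun c @` A) v * vol_density c v)%:E).

(* - |G|^(-1/2) sum_i d_i (|G|^(1/2) sum_j G^(ij) d_j f): the Laplacian with
   nonnegative spectrum, in the chart [c], at the coordinate [v]. *)
Definition laplacian_in (c : chart R d M) (f : M -> R) (v : 'rV[R]_d) : R :=
  - ((vol_density c v)^-1 *
     \sum_(i < d) 'D_(delta_mx 0 i)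
       (fun u => vol_density c u *
          \sum_(j < d) invmx (gram c u) i j *
                       'D_(delta_mx 0 j) (f \o cinv c) u) v).

Definition eigenfunction (f : M -> R) (l : R) : Prop :=
  smooth f /\ forall c x, atlas c -> cdom c x ->
    laplacian_in c f (cfun c x) = l * f x.

Definition orthonormal_basis (mu : {measure set (borel M) -> \bar R})
    (b : nat -> borel M -> R) : Prop :=
  [/\ forall n, b n \in Lfun mu 2%:E,
      forall m n, \int[mu]_x (b m x * b n x) = (m == n)%:R &
      forall f : borel M -> R, f \in Lfun mu 2%:E ->
        'N[mu]_2%:E[(fun x => (f x -
            \sum_(k < n) (\int[mu]_y (f y * b k y)) * b k x)%:E)]%E
          @[n --> \oo] --> 0%E].

End riemannian.

Section hamiltonian.
Context {R : realType} {d : nat} (M : closed_manifold R d).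
Variable omega : M -> tvec M -> tvec M -> R.

(* Time-dependent functions are maps [R -> M -> R]; only times in [0,1]
   matter. *)
Definition smooth_ham (H : R -> M -> R) : Prop :=
  forall c : chart R d M, atlas c ->
    smooth_on [set v : 'rV[R]_(1 + d) |
                 unit_itv (lsubmx v 0 0) /\ cim c (rsubmx v)]
              (fun v => H (lsubmx v 0 0) (cinv c (rsubmx v))).

Definition ham_vfield (H : R -> M -> R) (X : R -> M -> tvec M) : Prop :=
  forall t x, unit_itv t -> tangent x (X t x) /\
    forall u, tangent x u -> omega x (X t x) u = - u (H t).

(* d/dt f (Phi_t x) = X_t (Phi_t x) f for all smooth [f], one-sided at the
   endpoints of [0,1]. *)
Definition is_flow (X : R -> M -> tvec M) (Phi : R -> M -> M) : Prop :=
  (forall x, Phi 0 x = x) /\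
  forall t x f, unit_itv t -> smooth f ->
    (s - t)^-1 * (f (Phi s x) - f (Phi t x))
      @[s --> within unit_itv t^'] --> (X t (Phi t x) f : R).

(* "phi_H^1 = phi", with [H] smooth; a relation, so that no junk flow has to be
   assigned to a non-smooth [H]. *)
Definition time_one (H : R -> M -> R) (phi : self_bij M) : Prop :=
  smooth_ham H /\ exists (X : R -> M -> tvec M) (Phi : R -> M -> M),
    [/\ ham_vfield H X, is_flow X Phi & Phi 1 =1 phi].

Definition Ham : set (self_bij M) := [set phi | exists H, time_one H phi].

Definition hofer_length (H : R -> M -> R) : \bar R :=
  (\int[lebesgue_measure]_(t in unit_itv)
     (sup (range (H t)) - inf (range (H t)))%R%:E)%E.

Definition hofer_norm (phi : self_bij M) : \bar R :=
  ereal_inf [set hofer_length H | H in [set H | time_one H phi]].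

Definition hofer_dist (phi chi : self_bij M) : \bar R :=
  hofer_norm (sb_comp (sbV phi) chi).

Definition hofer_open : set (set (self_bij M)) :=
  [set U | U `<=` Ham /\ forall phi, U phi ->
     exists2 e : R, 0 < e &
       forall chi, Ham chi -> (hofer_dist phi chi < e%:E)%E -> U chi].

Definition Ham_borel : set (set (self_bij M)) := <<s Ham, hofer_open >>.

End hamiltonian.

Section gaussian.
Context {R : realType} {disp : measure_display} {Omega : measurableType disp}.
Variable P : probability Omega R.

(* Degenerate Gaussians are allowed; they are treated separately because
   [normal_prob m 0] is not the Dirac mass at [m]. *)
Definition gaussian_rv (X : Omega -> R) : Prop :=
  exists m s : R, 0 <= s /\ forall B : set R, measurable B ->
    pushforward P X B = if s == 0 then \d_m B else normal_prob m s B.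

Definition gaussian_process (Z : R -> {RV P >-> R}) : Prop :=
  forall (k : nat) (t a : 'I_k -> R), (forall i, unit_itv (t i)) ->
    gaussian_rv (fun w => \sum_(i < k) a i * Z (t i) w).

(* Conditions on the family of processes in a law-defining datum. The
   almost sure smoothness of the sample paths is part of the definition: for
   an arbitrary version of a process it does not follow from smoothness of
   the mean and the covariance. *)
Definition admissible_processes (Z : nat -> R -> {RV P >-> R}) : Prop :=
  [/\ forall n, gaussian_process (Z n),
      exists C D : R, [/\ 0 <= C, 0 <= D,
        forall n t, unit_itv t ->
          (covariance P (Z n t) (Z n t) < C%:E)%E &
        forall n, (\int[P]_w ereal_sup
          [set `|Z n t w|%R%:E | t in unit_itv] < D%:E)%E],
      forall n, smooth_time2 (fun t1 t2 =>
        fine (covariance P (Z n t1) (Z n t2))),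
      forall n, smooth_time (fun t => fine ('E_P[Z n t])%E) &
      forall n, {ae P, forall w, smooth_time (fun t => Z n t w)}].

End gaussian.

(* The families (e_n) and (Z_n), n >= 1, are indexed from 0: [ld_e n] and
   [ld_Z n] are e_(n+1) and Z_(n+1). *)
Record law_data (R : realType) (d : nat) (M : closed_manifold R d)
    (disp : measure_display) (Omega : measurableType disp)
    (P : probability Omega R) := LawData {
  ld_r : R;
  ld_J : M -> tvec M -> tvec M;
  ld_e : nat -> M -> R;
  ld_Z : nat -> R -> {RV P >-> R} }.

Section law.
Context {R : realType} {d : nat} (M : closed_manifold R d).
Variable omega : M -> tvec M -> tvec M -> R.
Context {disp : measure_display} {Omega : measurableType disp}.
Variable P : probability Omega R.
Implicit Types D : law_data M P.

Definition ld_metric D : M -> tvec M -> tvec M -> R := metric_of omega (ld_J D).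

(* The eigenvalue of [ld_e D n], i.e. lambda_(n+1). *)
Definition ld_lambda D (n : nat) : R :=
  xget 0 [set l | eigenfunction (ld_metric D) (ld_e D n) l].

(* An orthonormal basis of eigenfunctions listed with nondecreasing eigenvalues
   lists all the eigenvalues with multiplicity. *)
Definition law_defining D : Prop :=
  [/\ 0 < ld_r D,
      compatible_acs omega (ld_J D),
      exists mu : {measure set (borel M) -> \bar R},
        is_volume (ld_metric D) mu /\
        orthonormal_basis mu (fun n => if n is n'.+1 then ld_e D n'
                                       else cst (Num.sqrt (fine (mu setT)))^-1),
      [/\ forall n, eigenfunction (ld_metric D) (ld_e D n) (ld_lambda D n),
          0 < ld_lambda D 0 &
          forall n, ld_lambda D n <= ld_lambda D n.+1] &
      admissible_processes (ld_Z D)].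

Definition random_ham D (w : Omega) : R -> M -> R := fun t x =>
  limn (series (fun n =>
    expR (- (2^-1 * ld_lambda D n * ld_r D)) * ld_Z D n t w * ld_e D n x)).

(* The law of phi^1_{H^rand}. The sample paths are smooth only almost surely,
   so the event below is measurable up to a P-null set; [mu_ext P] is the
   canonical extension of [P] to such events. *)
Definition ham_law D : set (self_bij M) -> \bar R := fun A =>
  mu_ext P [set w | exists2 phi, A phi & time_one omega (random_ham D w) phi].

Definition conj_push (psi : self_bij M) (mu : set (self_bij M) -> \bar R) :
  set (self_bij M) -> \bar R := fun A =>
  mu [set sb_comp (sb_comp (sbV psi) phi) psi | phi in A].

Definition acs_push (psi : self_bij M) (J : M -> tvec M -> tvec M) :
  M -> tvec M -> tvec M := fun x v =>
  differential psi (J (sbV psi x) (differential (sbV psi) v)).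

Definition ld_push (psi : self_bij M) D : law_data M P :=
  LawData (ld_r D) (acs_push psi (ld_J D))
    (fun n => ld_e D n \o sbV psi) (ld_Z D).

End law.

(* Main.v *)
Require Import Defs.
From mathcomp Require Import all_boot all_order all_algebra.
From mathcomp Require Import all_classical all_reals all_analysis.

Set Implicit Arguments.
Unset Strict Implicit.
Unset Printing Implicit Defensive.

Import GRing.Theory.
Import numFieldNormedType.Exports.

Local Open Scope classical_set_scope.
Local Open Scope ring_scope.

(** The theorem is naturality: a symplectomorphism [psi] transports every
    structure that enters the definition of the law, so the two laws are
    outer probabilities of the same set of sample points.

    Everything rests on [atlas_chart_pull]: if [c] is a chart of the maximal
    atlas, then so is [c \o psi]. A function [f \o psi^-1] read in the chart
    [c] is literally the function [f] read in the chart [c \o psi], over the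
    same open set of coordinates. Hence smoothness of functions and of
    Hamiltonians is transported without any chain rule.

    For the eigenvalues, [d psi^-1] maps the coordinate vectors of [c] to those
    of [c \o psi], and [psi] preserves [omega], so the Gram matrix of the pushed
    metric in [c] equals that of the original metric in [c \o psi]
    ([gram_push]). The Laplacian, a coordinate formula in the Gram matrix, is
    therefore transported as well, and [e_n] and [e_n \o psi^-1] have the same
    eigenvalues ([eigenfunction_pushE]). The preservation of [omega] is only
    assumed on tangent vectors, so coordinate vectors must be shown to be
    derivations ([coord_vec_tangent]); this is the only differential calculus
    in the proof.

    Equal eigenvalues give equal weights, so the random Hamiltonian of the
    pushed datum is [H^rand_t \o psi^-1] ([random_ham_push]). Finally
    [H_t \o psi^-1] generates [phi] at time one exactly when [H] generates
    [psi^-1 \o phi \o psi] ([time_one_conj]). *)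

(** * Sums and products of smooth functions *)

Section smooth_functions.
Context {R : realType} {n : nat}.
Implicit Types (W A : set 'rV[R]_n) (f g : 'rV[R]_n -> R).

Lemma open_near_eq W f g v : open W -> W v -> (forall x, W x -> f x = g x) ->
  \forall x \near v, f x = g x.
Proof.
move=> oW Wv fg; have : nbhs v W by exact: open_nbhs_nbhs.
by apply: filterS => x /fg.
Qed.

(** Openness of [W] is essential: the derivatives at a point of [W] must only see
    the values on [W]. *)
Lemma Ck_eq k W f g : open W -> (forall x, W x -> f x = g x) ->
  Ck k W f -> Ck k W g.
Proof.
move=> oW; elim: k f g => [|k IH] f g fg /= [cf df]; (split; last first).
- by [].
- apply: subspace_eq_continuous cf => x; rewrite inE; exact: fg.
- move=> i; have [di Di] := df i; split.
    move=> x Wx; apply: near_eq_derivable (di x Wx); exact: (open_near_eq oW).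
  apply: IH Di => x Wx; apply: near_eq_derive; exact: (open_near_eq oW).
- apply: subspace_eq_continuous cf => x; rewrite inE; exact: fg.
Qed.

Lemma CkS k W f : Ck k.+1 W f -> Ck k W f.
Proof.
elim: k f => [|k IH] f; first by case.
move=> [cf df]; split => // i; have [di Di] := df i; split => //; exact: IH.
Qed.

Lemma Ck_subset k W A f : A `<=` W -> Ck k W f -> Ck k A f.
Proof.
move=> AW; elim: k f => [|k IH] f /= [cf df];
  (split; first exact: continuous_subspaceW cf) => // i.
by have [di Di] := df i; split; [move=> x /AW/di|exact: IH].
Qed.

Lemma Ck_cst k W (a : R) : Ck k W (fun=> a).
Proof.
elim: k a => [|k IH] a; (split; first exact: cst_continuous) => // i.
split=> [x _|]; first exact: derivable_cst.
have -> : 'D_(delta_mx 0 i) (fun=> a) = (fun=> 0) :> ('rV[R]_n -> R).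
  by apply/funext => x; exact: derive_cst.
exact: IH.
Qed.

Lemma CkD k W f g : open W -> Ck k W f -> Ck k W g ->
  Ck k W (fun x => f x + g x).
Proof.
move=> oW; elim: k f g => [|k IH] f g [cf df] [cg dg];
  (split; first by move=> x; apply: continuousD; [exact: cf|exact: cg]) => // i.
have [df1 Df] := df i; have [dg1 Dg] := dg i; split.
  by move=> x Wx; apply: derivableD; [exact: df1|exact: dg1].
apply: Ck_eq oW _ (IH _ _ Df Dg) => x Wx.
by rewrite -deriveD//; [exact: df1|exact: dg1].
Qed.

(** By the Leibniz rule [D (f * g)] is built from [f], [g] and their derivatives,
    all of class [C^k] when [f] and [g] are of class [C^(k+1)], hence [CkS]. *)
Lemma CkM k W f g : open W -> Ck k W f -> Ck k W g ->
  Ck k W (fun x => f x * g x).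
Proof.
move=> oW; elim: k f g => [|k IH] f g Cf Cg;
  case: (Cf) => cf df; case: (Cg) => cg dg;
  (split; first by move=> x; apply: continuousM; [exact: cf|exact: cg]) => // i.
have [df1 Df] := df i; have [dg1 Dg] := dg i; split.
  by move=> x Wx; apply: derivableM; [exact: df1|exact: dg1].
apply: Ck_eq oW _ (CkD oW (IH _ _ (CkS Cf) Dg) (IH _ _ (CkS Cg) Df)) => x Wx.
by rewrite -[LHS]/(_ *: _ + _ *: _) -deriveM//; [exact: df1|exact: dg1].
Qed.

Lemma smooth_on_cst A (a : R) : smooth_on A (fun=> a).
Proof.
move=> p _; exists setT, (fun=> a); split => //; first exact: openT.
by move=> k; exact: Ck_cst.
Qed.

Lemma smooth_onD A f g : smooth_on A f -> smooth_on A g ->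
  smooth_on A (fun x => f x + g x).
Proof.
move=> sf sg p Ap.
have [W1 [u1 [oW1 W1p C1 e1]]] := sf p Ap.
have [W2 [u2 [oW2 W2p C2 e2]]] := sg p Ap.
exists (W1 `&` W2), (fun x => u1 x + u2 x); split => //; first exact: openI.
  move=> k; apply: CkD; first exact: openI.
    exact: Ck_subset (C1 k).
  exact: Ck_subset (C2 k).
by move=> x Ax [x1 x2]; rewrite e1 // e2.
Qed.

Lemma smooth_onM A f g : smooth_on A f -> smooth_on A g ->
  smooth_on A (fun x => f x * g x).
Proof.
move=> sf sg p Ap.
have [W1 [u1 [oW1 W1p C1 e1]]] := sf p Ap.
have [W2 [u2 [oW2 W2p C2 e2]]] := sg p Ap.
exists (W1 `&` W2), (fun x => u1 x * u2 x); split => //; first exact: openI.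
  move=> k; apply: CkM; first exact: openI.
    exact: Ck_subset (C1 k).
  exact: Ck_subset (C2 k).
by move=> x Ax [x1 x2]; rewrite e1 // e2.
Qed.

Lemma smooth_on_derivable A f v i : open A -> smooth_on A f -> A v ->
  derivable f v (delta_mx 0 i).
Proof.
move=> oA sf Av; have [W [h [oW Wv Ch he]]] := sf v Av.
have [_ dh] := Ch 1%N; have {}dh := (dh i).1 v Wv.
apply: near_eq_derivable dh; apply: (@open_near_eq (A `&` W)) => //.
  exact: openI.
by move=> x [Ax Wx]; exact: he.
Qed.

End smooth_functions.

(** * Coordinate vectors are tangent vectors *)

Section manifold.
Context {R : realType} {d : nat} (M : closed_manifold R d).
Implicit Types (f g : M -> R) (c : chart R d M) (x : M).

Lemma smooth_cst (a : R) : smooth (fun _ : M => a).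
Proof. by move=> c _; exact: smooth_on_cst. Qed.

Lemma smoothD f g : smooth f -> smooth g -> smooth (fun x => f x + g x).
Proof. by move=> sf sg c ac; apply: smooth_onD; [exact: sf|exact: sg]. Qed.

Lemma smoothM f g : smooth f -> smooth g -> smooth (fun x => f x * g x).
Proof. by move=> sf sg c ac; apply: smooth_onM; [exact: sf|exact: sg]. Qed.

(** The partial derivatives obey linearity and the Leibniz rule, but [coord_vec]
    vanishes by convention on non-smooth functions; this is why smooth functions
    have to be known to form an algebra. *)
Lemma coord_vec_tangent c x i : atlas c -> cdom c x ->
  tangent x (coord_vec c x i).
Proof.
move=> ac cx; have [_ oim cK _ _] := atlas_chart ac.
have imx : cim c (cfun c x) by exists x.
have df f : smooth f -> derivable (f \o cinv c) (cfun c x) (delta_mx 0 i).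
  by move=> sf; exact: smooth_on_derivable oim (sf c ac) imx.
split=> [f nf|a f g sf sg|f g sf sg]; rewrite /coord_vec; first by rewrite asboolF.
- rewrite !asboolT//; last by apply: smoothD => //; apply: smoothM => //; exact: smooth_cst.
  have -> : (fun y => a * f y + g y) \o cinv c =
    a \*: (f \o cinv c) + (g \o cinv c) by [].
  rewrite deriveD ?deriveZ//; [exact: df|apply: derivableZ; exact: df|exact: df].
- rewrite !asboolT//; last exact: smoothM.
  have -> : (fun y => f y * g y) \o cinv c = (f \o cinv c) * (g \o cinv c) by [].
  by rewrite deriveM /= ?cK//; exact: df.
Qed.

End manifold.

(** * Transport by a diffeomorphism *)

Section transport.
Context {R : realType} {d : nat} (M : closed_manifold R d).
Implicit Types (f : M -> R) (c : chart R d M) (psi : self_bij M).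

Definition diffeo psi : Prop := smooth_map psi /\ smooth_map (sbV psi).

Definition chart_pull psi c : chart R d M :=
  Chart (psi @^-1` cdom c) (cfun c \o psi) (sbV psi \o cinv c).

Lemma sbVV psi : sbV (sbV psi) = psi.
Proof. by case: psi. Qed.

Lemma diffeoV psi : diffeo psi -> diffeo (sbV psi).
Proof. by move=> [s sV]; split; rewrite ?sbVV. Qed.

Lemma cim_chart_pull psi c : cim (chart_pull psi c) = cim c.
Proof.
apply/seteqP; split=> v [x] /= cx <-; first by exists (psi x).
by exists (sbV psi x); rewrite /= sb_invK.
Qed.

(** By maximality it suffices that [c \o psi] is compatible with each chart [c'].
    The two transition maps are the coordinate expressions of [psi^-1] from [c]
    to [c'] and of [psi] from [c'] to [c], which are smooth by hypothesis. *)
Lemma atlas_chart_pull psi c : diffeo psi -> atlas c -> atlas (chart_pull psi c).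
Proof.
move=> [[cpsi spsi] [cV sV]] ac; have [oD oI cK cc ci] := atlas_chart ac.
apply: atlas_maximal.
  split; rewrite ?cim_chart_pull //=.
  - by move/continuousP: cpsi; exact.
  - by move=> x cx; rewrite cK //; exact: sb_funK.
  - have oP : open (psi @^-1` cdom c) by move/continuousP: cpsi; exact.
    rewrite continuous_open_subspace // => x; rewrite inE => Dx.
    apply: continuous_comp; first exact: cpsi.
    by move: cc; rewrite continuous_open_subspace //; apply; rewrite inE.
  - rewrite continuous_open_subspace // => v cv.
    apply: continuous_comp; last exact: cV.
    by move: ci; rewrite continuous_open_subspace //; exact.
move=> c' ac'; split=> i; last exact: spsi.
rewrite (_ : _ @` _ = cfun c @` (cdom c `&` sbV psi @^-1` cdom c')).
  exact: sV.
apply/seteqP; split=> v [x] /= [cx c'x] <-.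
  by exists (psi x) => //=; rewrite sb_funK.
by exists (sbV psi x) => /=; rewrite sb_invK.
Qed.

Lemma smooth_comp_sbV psi f : diffeo psi -> smooth f -> smooth (f \o sbV psi).
Proof.
by move=> dpsi sf c ac; rewrite -(cim_chart_pull psi); exact/sf/atlas_chart_pull.
Qed.

Lemma smooth_comp psi f : diffeo psi -> smooth f -> smooth (f \o psi).
Proof. by move=> /diffeoV dpsi /(smooth_comp_sbV dpsi); rewrite sbVV. Qed.

Lemma smooth_compE psi f : diffeo psi -> smooth (f \o psi) <-> smooth f.
Proof.
move=> dpsi; split=> [/(smooth_comp_sbV dpsi)|]; last exact: smooth_comp.
by congr smooth; apply/funext => x /=; rewrite sb_invK.
Qed.

Lemma differentialK psi (v : tvec M) :
  differential (sbV psi) (differential psi v) = v.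
Proof.
by apply/funext => f; congr v; apply/funext => x /=; rewrite sb_funK.
Qed.

Lemma differentialVK psi (v : tvec M) :
  differential psi (differential (sbV psi) v) = v.
Proof. by rewrite -{1}(sbVV psi) differentialK. Qed.

Lemma differential_tangent psi x (v : tvec M) : diffeo psi -> tangent x v ->
  tangent (psi x) (differential psi v).
Proof.
move=> dpsi [v0 vD vM]; split=> [f nf|a f g sf sg|f g sf sg].
- by apply: v0 => /smooth_compE; tauto.
- by apply: vD; exact: smooth_comp.
- by apply: vM; exact: smooth_comp.
Qed.

Lemma differentialV_tangent psi y (v : tvec M) : diffeo psi -> tangent y v ->
  tangent (sbV psi y) (differential (sbV psi) v).
Proof. by move=> /diffeoV; exact: differential_tangent. Qed.

(** Both sides differentiate [f \o psi^-1 \o c^-1] at the same coordinates; it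
    remains to match the smoothness tests on [f \o psi^-1] and on [f]. *)
Lemma coord_vec_pull psi c y i : diffeo psi ->
  differential (sbV psi) (coord_vec c y i) =
  coord_vec (chart_pull psi c) (sbV psi y) i.
Proof.
move=> dpsi; apply/funext => f.
rewrite /differential /coord_vec /= sb_invK.
congr (if _ then _ else _); apply: asbool_equiv_eq.
exact: smooth_compE (diffeoV dpsi).
Qed.

Lemma acs_pushK psi (J : M -> tvec M -> tvec M) :
  acs_push (sbV psi) (acs_push psi J) = J.
Proof.
apply/funext => x; apply/funext => v.
by rewrite /acs_push sbVV differentialK [sbV psi (psi x)]sb_funK differentialK.
Qed.

Lemma acs_push_tangent psi (J : M -> tvec M -> tvec M) : diffeo psi ->
  (forall x v, tangent x v -> tangent x (J x v)) ->
  forall x v, tangent x v -> tangent x (acs_push psi J x v).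
Proof.
move=> dpsi JT x v Tv; rewrite -{1}(sb_invK psi x).
exact/differential_tangent/JT/differentialV_tangent.
Qed.

End transport.

(** * Transport by a symplectomorphism *)

Section symplectic.
Context {R : realType} {d : nat} (M : closed_manifold R d).
Variable omega : M -> tvec M -> tvec M -> R.
Implicit Types (f : M -> R) (c : chart R d M) (J : M -> tvec M -> tvec M).

Lemma Symp_diffeo (psi : self_bij M) : Symp omega psi -> diffeo psi.
Proof. by case. Qed.

Lemma SympV (psi : self_bij M) : Symp omega psi -> Symp omega (sbV psi).
Proof.
move=> psiS; have dpsi := Symp_diffeo psiS; have [s sV inv] := psiS.
split; rewrite ?sbVV // => x v w Tv Tw.
rewrite -inv; try exact: differentialV_tangent.
by rewrite [psi (sbV psi x)]sb_invK !differentialVK.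
Qed.

Lemma metric_push (psi : self_bij M) J y u v : Symp omega psi ->
  (forall x v, tangent x v -> tangent x (J x v)) ->
  tangent y u -> tangent y v ->
  metric_of omega (acs_push psi J) y u v =
  metric_of omega J (sbV psi y) (differential (sbV psi) u)
    (differential (sbV psi) v).
Proof.
move=> psiS JT Tu Tv; have dpsi := Symp_diffeo psiS.
have [_ _ inv] := SympV psiS.
rewrite /metric_of -inv //; last exact: acs_push_tangent.
by rewrite /acs_push differentialK.
Qed.

Lemma gram_push (psi : self_bij M) J c v : Symp omega psi ->
  (forall x v, tangent x v -> tangent x (J x v)) ->
  atlas c -> cim c v ->
  gram (metric_of omega (acs_push psi J)) c v =
  gram (metric_of omega J) (chart_pull psi c) v.
Proof.
move=> psiS JT ac [x cx <-{v}]; have [_ _ cK _ _] := atlas_chart ac.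
have dpsi := Symp_diffeo psiS.
apply/matrixP => i j; rewrite !mxE /= cK // metric_push //;
  try exact: coord_vec_tangent.
by rewrite !coord_vec_pull.
Qed.

(** The coefficients agree on the open set [cim c] only, which suffices because
    the outer derivative is local. *)
Lemma laplacian_push (psi : self_bij M) J c f v : Symp omega psi ->
  (forall x v, tangent x v -> tangent x (J x v)) ->
  atlas c -> cim c v ->
  laplacian_in (metric_of omega (acs_push psi J)) c (f \o sbV psi) v =
  laplacian_in (metric_of omega J) (chart_pull psi c) f v.
Proof.
move=> psiS JT ac cv; have [_ oI _ _ _] := atlas_chart ac.
have gramE u : cim c u -> gram (metric_of omega (acs_push psi J)) c u =
    gram (metric_of omega J) (chart_pull psi c) u.
  exact: gram_push.
have volE u : cim c u -> vol_density (metric_of omega (acs_push psi J)) c u =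
    vol_density (metric_of omega J) (chart_pull psi c) u.
  by move=> cu; rewrite /vol_density gramE.
rewrite /laplacian_in (volE v cv); congr (- (_ * _)).
apply: eq_bigr => i _; apply: near_eq_derive; apply: (open_near_eq oI cv).
by move=> u cu; rewrite (volE u cu) (gramE u cu).
Qed.

Lemma eigenfunction_push (psi : self_bij M) J f l : Symp omega psi ->
  (forall x v, tangent x v -> tangent x (J x v)) ->
  eigenfunction (metric_of omega J) f l ->
  eigenfunction (metric_of omega (acs_push psi J)) (f \o sbV psi) l.
Proof.
move=> psiS JT [sf ef]; have dpsi := Symp_diffeo psiS.
split=> [|c y ac cy]; first exact: smooth_comp_sbV.
rewrite laplacian_push //; last by exists y.
have := ef (chart_pull psi c) (sbV psi y) (atlas_chart_pull dpsi ac).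
by rewrite /= sb_invK; exact.
Qed.

(** The converse is the transport by [psi^-1], which undoes the pushes of [J] and
    of [f]. *)
Lemma eigenfunction_pushE (psi : self_bij M) J f l : Symp omega psi ->
  (forall x v, tangent x v -> tangent x (J x v)) ->
  eigenfunction (metric_of omega (acs_push psi J)) (f \o sbV psi) l <->
  eigenfunction (metric_of omega J) f l.
Proof.
move=> psiS JT; split; last exact: eigenfunction_push.
have dpsi := Symp_diffeo psiS.
move/(eigenfunction_push (SympV psiS) (acs_push_tangent dpsi JT)).
rewrite acs_pushK sbVV; congr (eigenfunction _ _ _).
by apply/funext => x /=; rewrite sb_funK.
Qed.

(** If [X] and [Phi] are the vector field and the flow of [H], then
    [H_t \o psi^-1] has the vector field [psi_* X_t] because [psi] preserves
    [omega], and the flow [psi \o Phi_t \o psi^-1]. The conjugacy is stated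
    pointwise to avoid comparing the inverses carried by a [self_bij]. *)
Lemma time_one_push (psi chi phi : self_bij M) H : Symp omega psi ->
  time_one omega H chi -> psi \o chi =1 phi \o psi ->
  time_one omega (fun t => H t \o sbV psi) phi.
Proof.
move=> psiS [sH [X [Phi [hX [Phi0 dPhi] Phi1]]]] conj.
have dpsi := Symp_diffeo psiS; have [_ _ inv] := psiS.
split=> [c ac|].
  by rewrite -(cim_chart_pull psi); exact/sH/atlas_chart_pull.
exists (fun t y => differential psi (X t (sbV psi y))).
exists (fun t y => psi (Phi t (sbV psi y))); split=> [t y ut||y].
- have [TX eX] := hX t (sbV psi y) ut; split.
    by rewrite -{1}(sb_invK psi y); exact: differential_tangent.
  move=> u Tu; rewrite -[u in LHS](differentialVK psi).
  rewrite -{1}(sb_invK psi y) inv //; last exact: differentialV_tangent.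
  by rewrite eX //; exact: differentialV_tangent.
- split=> [y|t y f ut sf]; first by rewrite Phi0; exact: sb_invK.
  rewrite /= sb_funK.
  by apply: (dPhi t _ (f \o psi) ut); exact: smooth_comp.
- by rewrite Phi1; move: (conj (sbV psi y)) => /= ->; rewrite sb_invK.
Qed.

Lemma time_one_conj (psi phi : self_bij M) H : Symp omega psi ->
  time_one omega (fun t => H t \o sbV psi) phi <->
  time_one omega H (sb_comp (sb_comp (sbV psi) phi) psi).
Proof.
move=> psiS; split=> h; last first.
  by apply: time_one_push psiS h _ => x /=; rewrite sb_invK.
have := time_one_push (SympV psiS) h.
rewrite (_ : (fun t => _) = H).
  by apply=> x /=; rewrite sb_invK.
by apply/funext => t; apply/funext => x /=; rewrite sb_funK.
Qed.

End symplectic.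

(** * Equality of the laws *)

Section law.
Context {R : realType} {d : nat} (M : closed_manifold R d).
Variable omega : M -> tvec M -> tvec M -> R.
Context {disp : measure_display} {Omega : measurableType disp}.
Variable P : probability Omega R.

Lemma ld_lambda_push (D : law_data M P) (psi : self_bij M) n :
  Symp omega psi -> (forall x v, tangent x v -> tangent x (ld_J D x v)) ->
  ld_lambda omega (ld_push psi D) n = ld_lambda omega D n.
Proof.
move=> psiS JT; congr xget; apply/seteqP.
by split=> l /=; rewrite /ld_metric /= eigenfunction_pushE.
Qed.

Lemma random_ham_push (D : law_data M P) (psi : self_bij M) w :
  Symp omega psi -> (forall x v, tangent x v -> tangent x (ld_J D x v)) ->
  random_ham omega (ld_push psi D) w =
  fun t => random_ham omega D w t \o sbV psi.
Proof.
move=> psiS JT; apply/funext => t; apply/funext => x.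
rewrite /random_ham /=; congr (limn (series _)); apply/funext => n.
by rewrite ld_lambda_push.
Qed.

End law.

Theorem theorem3p4 (R : realType) (d : nat) (M : closed_manifold R d)
  (omega : M -> tvec M -> tvec M -> R)
  (disp : measure_display) (Omega : measurableType disp)
  (P : probability Omega R) (D : law_data M P) (psi : self_bij M)
  (homega : symplectic_form omega)
  (hD : law_defining omega D)
  (hpsi : Symp omega psi) :
  forall A : set (self_bij M), Ham_borel omega A ->
    conj_push psi (ham_law omega D) A = ham_law omega (ld_push psi D) A.
Proof.
move=> A _; have [_ [[JT _ _ _] _] _ _ _] := hD.
congr (mu_ext P); apply/seteqP; split=> w /=.
  move=> [_ [phi Aphi <-]] h; exists phi => //.
  by rewrite random_ham_push //; exact/time_one_conj.
move=> [phi Aphi]; rewrite random_ham_push // => /time_one_conj h.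
by exists (sb_comp (sb_comp (sbV psi) phi) psi); [exists phi|exact: h].
Qed.
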